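(* Let $n\geq 1$. Consider the square matrices $A=(A_{ST})$, $B=(B_{ST})$, $\Gamma=(\Gamma_{ST})$ with rows and columns indexed by subsets $S,T\subseteq[n-1]$, where $$A_{ST}=\#\{w\in\mathfrak{S}_n : \overline{S}\subseteq C(w),\ T\subseteq D(w)\},\quad B_{ST}=\#\{w\in\mathfrak{S}_n : \overline{S}\subseteq C(w),\ T= D(w)\},$$ $$\Gamma_{ST}=\#\{w\in\mathfrak{S}_n : C(w)=\overline{S},\ D(w)=T\}.$$ Then $A,B,\Gamma$ are invertible, and writing $N^{-1}_{ST}$ for the $(S,T)$-entry of $N^{-1}$, $$A^{-1}_{ST}=(-1)^{\#S+\#T}A_{ST},\qquad B^{-1}_{ST}=(-1)^{\#S+\#T}\,\#\{w\in\mathfrak{S}_n : \overline{S}=C(w),\ T\subseteq D(w)\},\qquad \Gamma^{-1}_{ST}=(-1)^{\#S+\#T}\Gamma_{ST}.$$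
   Context: $[n]=\{1,\dots,n\}$, $\mathfrak{S}_n$ is the set of permutations $w=a_1\cdots a_n$ of $[n]$. For $X\subseteq[n-1]$, $\overline{X}=[n-1]\setminus X$. The descent set is $D(w)=\{i : a_i>a_{i+1}\}$. The connectivity set is $C(w)=\{i\in[n-1] : a_j<a_k \text{ for all } j\leq i<k\}$. *)

(* Defs.v *)
From HB Require Import structures.
From mathcomp Require Import all_boot all_order all_algebra all_fingroup.

Set Implicit Arguments.
Unset Strict Implicit.
Unset Printing Implicit Defensive.

Import GRing.Theory.
Local Open Scope ring_scope.

(* Everything is shifted down by one: the ordinal i : 'I_n stands for the      *)
(* element i + 1 of [n], and i : 'I_n.-1 for the element i + 1 of [n-1], so     *)
(* that the word of w : 'S_n is a_(i+1) = w i + 1.                              *)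

Definition descent_set (n : nat) (w : 'S_n) : {set 'I_n.-1} :=
  [set i : 'I_n.-1 | [exists j : 'I_n, exists k : 'I_n,
     [&& j == i :> nat, k == i.+1 :> nat & (w k < w j)%N]]].

Definition connectivity_set (n : nat) (w : 'S_n) : {set 'I_n.-1} :=
  [set i : 'I_n.-1 | [forall j : 'I_n, forall k : 'I_n,
     (j <= i < k)%N ==> (w j < w k)%N]].

Definition num_A (n : nat) (S T : {set 'I_n.-1}) : nat :=
  #|[set w : 'S_n | (~: S \subset connectivity_set w)
                    && (T \subset descent_set w)]|.

Definition num_B (n : nat) (S T : {set 'I_n.-1}) : nat :=
  #|[set w : 'S_n | (~: S \subset connectivity_set w)
                    && (T == descent_set w)]|.

Definition num_Binv (n : nat) (S T : {set 'I_n.-1}) : nat :=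
  #|[set w : 'S_n | (~: S == connectivity_set w)
                    && (T \subset descent_set w)]|.

Definition num_Gamma (n : nat) (S T : {set 'I_n.-1}) : nat :=
  #|[set w : 'S_n | (connectivity_set w == ~: S)
                    && (descent_set w == T)]|.

(* MathComp matrices are indexed by ordinals; a matrix with rows and columns    *)
(* indexed by a finite type I is transported along the enumeration of I.        *)
Definition fin_mx (I : finType) (f : I -> I -> nat) : 'M[rat]_#|I| :=
  \matrix_(i, j) (f (enum_val i) (enum_val j))%:R.

Definition fin_entry (I : finType) (M : 'M[rat]_#|I|) (S T : I) : rat :=
  M (enum_rank S) (enum_rank T).

(* Main.v *)
(* For X a subset of [n-1], the permutations w with ~X in C(w) form the Young
   subgroup Y_X whose blocks are the maximal runs of positions linked by X.  For
   T in S, every coset of Y_T in Y_S contains exactly one w with T in D(w),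
   namely the one decreasing on each block of T.  Hence
   A_ST = [T in S] #Y_S / #Y_T, and A^-1 = D A D with D = diag((-1)^#S) follows
   from the vanishing of the alternating sum over a nontrivial Boolean interval.
   The same holds for the zeta matrix Z_ST = [T in S].  Finally A = B Z = Z M =
   Z Gamma Z, where M_ST = #{w : C(w) = ~S, T in D(w)}, so that
   B^-1 = Z A^-1 = D M D and Gamma^-1 = Z A^-1 Z = D Gamma D. *)

Require Import Defs.
From HB Require Import structures.
From mathcomp Require Import all_boot all_order all_algebra all_fingroup.

Set Implicit Arguments.
Unset Strict Implicit.
Unset Printing Implicit Defensive.

Import GRing.Theory Num.Theory.
Local Open Scope ring_scope.

(** * Young subgroups and the descents of permutations in their cosets *)

Section YoungSubgroups.
Local Open Scope nat_scope.
Local Open Scope group_scope.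
Variable n : nat.
Implicit Types (i : 'I_n) (j k : 'I_n.+1) (S T : {set 'I_n}) (w v : 'S_n.+1).

(* The two positions compared at the potential descent [i]. *)
Definition lpos i : 'I_n.+1 := widen_ord (leqnSn n) i.
Definition rpos i : 'I_n.+1 := lift ord0 i.

Lemma val_rpos i : rpos i = i.+1 :> nat. Proof. by []. Qed.

Lemma in_descent_set w i :
  (i \in @descent_set n.+1 w) = (w (rpos i) < w (lpos i))%N.
Proof.
rewrite inE; apply/existsP/idP => [[j /existsP[k /and3P[/eqP ji /eqP ki]]]|lt_w].
  have -> : j = lpos i by apply: val_inj.
  by have -> : k = rpos i by apply: val_inj.
by exists (lpos i); apply/existsP; exists (rpos i); rewrite !eqxx.
Qed.

(** Both sides say that [w] stabilises the initial segment of positions up to [i]: if one of its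
    elements went above [i], then it and all later positions would inject into the too few values
    above [i]. This form is visibly closed under composition. *)
Lemma in_connectivity_set w i :
  reflect (forall j, (j <= i)%N -> (w j <= i)%N) (i \in @connectivity_set n.+1 w).
Proof.
pose P := [set j : 'I_n.+1 | (j <= i)%N].
rewrite inE; apply: (iffP idP) => [/forallP Cw j le_ji|w_le].
  rewrite leqNgt; apply/negP => lt_iw.
  have sub : w @: (j |: ~: P) \subset ~: P.
    apply/subsetP => _ /imsetP[k /setU1P[->|kP] ->]; first by rewrite !inE -ltnNge.
    move: kP; rewrite !inE -!ltnNge => lt_ik; have /forallP/(_ k)/implyP := Cw j.
    by rewrite le_ji lt_ik => /(_ isT); apply: ltn_trans.
  have := subset_leq_card sub; rewrite card_imset; last exact: perm_inj.
  by rewrite cardsU1 !inE le_ji ltnn.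
have wP : w @: P = P.
  apply/eqP; rewrite eqEcard card_imset ?leqnn ?andbT; last exact: perm_inj.
  by apply/subsetP => _ /imsetP[j jP ->]; move: jP; rewrite !inE => jP; apply: w_le.
apply/forallP => j; apply/forallP => k; apply/implyP => /andP[le_ji lt_ik].
apply: leq_ltn_trans (w_le _ le_ji) _; rewrite ltnNge; apply/negP => le_wk.
have : w k \in w @: P by rewrite wP inE.
by rewrite (mem_imset _ _ (@perm_inj _ w)) inE leqNgt lt_ik.
Qed.

Definition young S := [set w : 'S_n.+1 | ~: S \subset @connectivity_set n.+1 w].

Lemma youngP S w :
  reflect (forall i j, i \notin S -> (j <= i)%N -> (w j <= i)%N) (w \in young S).
Proof.
rewrite inE; apply: (iffP subsetP) => [sub i j iS|sub i].
  have /in_connectivity_set : i \in @connectivity_set n.+1 w.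
    by apply: sub; rewrite inE.
  exact.
by rewrite inE => iS; apply/in_connectivity_set => j; apply: sub.
Qed.

Lemma young_group_set S : group_set (young S).
Proof.
apply/group_setP; split=> [|v w /youngP Yv /youngP Yw].
  by apply/youngP => i j _; rewrite perm1.
by apply/youngP => i j iS le_ji; rewrite permM; apply/Yw/Yv.
Qed.

Canonical young_group S := Group (young_group_set S).

Lemma youngS S T : T \subset S -> young T \subset young S.
Proof.
move=> sTS; apply/subsetP => w; rewrite !inE; apply: subset_trans.
by rewrite setCS.
Qed.

Lemma tperm_young T i : i \in T -> tperm (lpos i) (rpos i) \in young T.
Proof.
move=> iT; apply/youngP => i' j i'T le_j; case: tpermP => [jE|jE|//].
- rewrite val_rpos ltn_neqAle; move: le_j; rewrite jE /= => ->; rewrite andbT.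
  by apply: contraNneq i'T => /val_inj <-.
- by move: le_j; rewrite jE val_rpos => /ltnW.
Qed.

(** Induction gives [j <= v j] for every [j]; both sides have the same sum over all [j], so each
    inequality is an equality. *)
Lemma perm_increasing_eq1 v :
  (forall i, (v (lpos i) < v (rpos i))%N) -> v = 1.
Proof.
move=> incr; have le_v m : forall j, val j = m -> (m <= v j)%N.
  elim: m => [//|m IHm] j jm.
  have lt_mn : (m < n)%N by rewrite -ltnS -jm ltn_ord.
  pose i := Ordinal lt_mn; have -> : j = rpos i by apply: val_inj.
  by apply: leq_ltn_trans (incr i); apply: IHm.
have le_sum : forall j, (true -> val j <= v j ?= iff (val j == val (v j)))%N.
  by move=> j; split=> //; apply: le_v.
have sumE : (\sum_(j < n.+1) val j = \sum_(j < n.+1) val (v j))%N.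
  by rewrite [LHS](reindex_inj (@perm_inj _ v)).
have [_] := leqif_sum le_sum; rewrite sumE eqxx => /esym/forallP vE.
by apply/permP => j; rewrite perm1; apply/val_inj/esym/eqP; have := vE j.
Qed.

Lemma descent_run T w j k : T \subset @descent_set n.+1 w -> (j < k)%N ->
  (forall i, (j <= i < k)%N -> i \in T) -> (w k < w j)%N.
Proof.
move=> /subsetP sTD; move: {2}(val k) (erefl (val k)) => m.
elim: m k => [|m IHm] k km lt_jk run; first by rewrite km in lt_jk.
have lt_mn : (m < n)%N by rewrite -ltnS -km ltn_ord.
pose i := Ordinal lt_mn; have kE : k = rpos i by apply: val_inj.
have le_jm : (j <= m)%N by rewrite -ltnS -km.
have lt_wk : (w k < w (lpos i))%N.
  by rewrite kE -in_descent_set; apply/sTD/run; rewrite km le_jm leqnn.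
move: le_jm; rewrite leq_eqVlt => /orP[/eqP jm|lt_jm].
  by have -> : j = lpos i by apply: val_inj.
apply: ltn_trans lt_wk _; apply: IHm => // i' /andP[le_ji' lt_i'm].
by apply: run; rewrite le_ji' km ltnS ltnW.
Qed.

(** Uniqueness of the coset representative. Since [v * w] sends [j] to [w (v j)], a drop of [v] at
    [i] in [T] stays inside one block of [T], where [w] decreases, so [v * w] would rise at [i].
    Outside [T], [v] rises by connectivity. *)
Lemma young_descent_eq1 T v w : v \in young T ->
  T \subset @descent_set n.+1 w -> T \subset @descent_set n.+1 (v * w) -> v = 1.
Proof.
move=> Yv sTw sTvw; apply: perm_increasing_eq1 => i.
have v_neq : v (lpos i) != v (rpos i) :> nat.
  by rewrite (inj_eq val_inj) (inj_eq perm_inj) -(inj_eq val_inj) neq_ltn leqnn.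
have Cv i' : i' \notin T -> i' \in @connectivity_set n.+1 v.
  by move=> i'T; apply/in_connectivity_set => j; apply: (youngP _ _ Yv).
have lt_conn i' j k : i' \notin T -> (j <= i' < k)%N -> (v j < v k)%N.
  by move=> /Cv; rewrite inE => /forallP/(_ j)/forallP/(_ k)/implyP.
have [iT|iT] := boolP (i \in T); last by apply: lt_conn iT _; rewrite !leqnn.
rewrite ltn_neqAle v_neq /= leqNgt; apply/negP => lt_v.
have /subsetP/(_ i iT) := sTvw; rewrite in_descent_set !permM.
rewrite ltnNge => /negP; apply.
apply/ltnW/(descent_run sTw lt_v) => i' /andP[le_i' lt_i'].
(* A cut [i'] outside [T] is respected by [v] and its inverse: [v (rpos i) <= i'] gives
   [rpos i <= i'], hence [lpos i <= i'] and [v (lpos i) <= i']. *)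
apply: contraLR lt_i' => i'T; rewrite -leqNgt.
have le_i := youngP _ _ (groupVr Yv) i' _ i'T le_i'; rewrite permK in le_i.
by apply: (youngP _ _ Yv) => //; apply: ltnW.
Qed.

(* A minimum of [weight] over a coset of [young T] has descents all over [T]. *)
Definition weight w := (\sum_(j < n.+1) j * w j)%N.

(** Rearrangement: exchanging values [a < b] at adjacent positions lowers the weighted sum by
    [b - a]. *)
Lemma weight_tperm w i : (w (lpos i) < w (rpos i))%N ->
  (weight (tperm (lpos i) (rpos i) * w) < weight w)%N.
Proof.
move=> lt_w; have ne : rpos i != lpos i.
  by rewrite -(inj_eq val_inj) neq_ltn ltnSn orbT.
rewrite /weight (bigD1 (lpos i)) //= [X in (_ < X)%N](bigD1 (lpos i)) //=.
rewrite (bigD1 (rpos i)) // [X in (_ < _ + X)%N](bigD1 (rpos i)) //.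
rewrite !permM tpermL tpermR [X in (X < _)%N]addnA [X in (_ < X)%N]addnA.
rewrite (eq_bigr (fun k : 'I_n.+1 => k * w k)%N); last first.
  by move=> k /andP[nk1 nk2]; rewrite permM tpermD 1?eq_sym.
rewrite ltn_add2r val_rpos !mulSn [X in (X < _)%N]addnCA [X in (_ < X)%N]addnCA.
by rewrite [X in (_ < _ + X)%N]addnC ltn_add2r.
Qed.

Lemma young_coset_rep T w :
  exists2 v, v \in young T & T \subset @descent_set n.+1 (v * w).
Proof.
have [v Yv v_min] := arg_minnP (fun v => weight (v * w)) (group1 (young_group T)).
exists v => //; apply/subsetP => i iT; rewrite in_descent_set ltn_neqAle.
apply/andP; split.
  rewrite (inj_eq val_inj) (inj_eq perm_inj) -(inj_eq val_inj).
  by rewrite neq_ltn ltnSn orbT.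
rewrite leqNgt; apply/negP => /weight_tperm; rewrite mulgA ltnNge.
by move=> /negP; apply; apply: v_min; apply: groupM Yv; apply: tperm_young.
Qed.

(** The permutations counted by [num_A] form a transversal of the right cosets of [young T] in
    [young S], so Lagrange's theorem applies. *)
Lemma card_young_descent S T : T \subset S ->
  (num_A (n := n.+1) S T * #|young T| = #|young S|)%N.
Proof.
move=> sTS; have sY := youngS sTS.
pose X := [set w in young S | T \subset @descent_set n.+1 w].
have -> : num_A (n := n.+1) S T = #|X|.
  by apply: eq_card => w; rewrite !inE.
have inj : {in X &, injective (fun w => young T :* w)}.
  move=> w w'; rewrite !inE => /andP[_ Dw] /andP[_ Dw'] eqc.
  have /rcosetP[v Yv wE] : w \in young T :* w' by rewrite -eqc rcoset_refl.
  by rewrite wE (young_descent_eq1 Yv Dw') ?mul1g // -wE.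
have imE : [set young T :* w | w in X] = rcosets (young T) (young S).
  apply/setP => C; apply/imsetP/rcosetsP => [[w wX ->]|[w Yw ->]].
    by exists w => //; move: wX; rewrite inE => /andP[].
  have [v Yv Dv] := young_coset_rep T w; exists (v * w).
    by rewrite inE Dv groupM // (subsetP sY).
  by rewrite rcosetM (rcoset_id Yv).
by rewrite -(card_in_imset inj) imE mulnC (Lagrange sY).
Qed.

(** An element of [T] outside [S] would be at once a descent and a connectivity point. *)
Lemma num_A_eq0 S T : ~~ (T \subset S) -> num_A (n := n.+1) S T = 0%N.
Proof.
case/subsetPn => i iT iS; apply: eq_card0 => w; rewrite inE.
apply/negP => /andP[/subsetP/(_ i) Cw /subsetP/(_ i iT)]; rewrite in_descent_set.
rewrite ltnNge => /negP; apply; apply: ltnW.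
have : i \in @connectivity_set n.+1 w by apply: Cw; rewrite inE.
rewrite inE => /forallP/(_ (lpos i))/forallP/(_ (rpos i))/implyP; apply.
by rewrite !leqnn.
Qed.

End YoungSubgroups.

(** * Matrices indexed by a finite type *)

Section FinMx.
Variable I : finType.
Implicit Types f g : I -> I -> nat.

Lemma fin_mx_mul f g :
  fin_mx f *m fin_mx g = fin_mx (fun i j => \sum_k f i k * g k j)%N.
Proof.
apply/matrixP => i j; rewrite !mxE natr_sum.
rewrite [RHS](reindex (@enum_val _ I)) /=; last first.
  by apply: onW_bij; apply: enum_val_bij.
by apply: eq_bigr => k _; rewrite !mxE natrM.
Qed.

Lemma eq_fin_mx f g : f =2 g -> fin_mx f = fin_mx g.
Proof. by move=> fg; apply/matrixP => i j; rewrite !mxE fg. Qed.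

End FinMx.

Lemma mulmx1_invmx (k : nat) (M N : 'M[rat]_k) :
  M *m N = 1%:M -> M \in unitmx /\ invmx M = N.
Proof.
move=> MN; have [uM _] := mulmx1_unit MN; split=> //.
by rewrite -[RHS](mulKmx uM) MN mulmx1.
Qed.

(** * Matrices indexed by subsets and their sign-twisted inverses *)

Section SubsetMatrices.
Variable X : finType.
Implicit Types (S T U : {set X}) (M N : 'M[rat]_#|{set X}|).

(* Conjugation by the diagonal matrix of the signs (-1)^#S. *)
Definition twist M : 'M[rat]_#|{set X}| :=
  \matrix_(i, j) ((-1) ^+ (#|(enum_val i : {set X})| + #|(enum_val j : {set X})|)
                  * M i j).

Lemma twistM M N : twist (M *m N) = twist M *m twist N.
Proof.
apply/matrixP => i j; rewrite !mxE mulr_sumr; apply: eq_bigr => k _.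
rewrite !mxE mulrACA; congr (_ * _); rewrite !exprD.
by rewrite mulrA -[in RHS](mulrA (_ ^+ _)) -expr2 sqrr_sign mulr1.
Qed.

Lemma twistK : involutive twist.
Proof.
by move=> M; apply/matrixP => i j; rewrite !mxE mulrA -expr2 sqrr_sign mul1r.
Qed.

Lemma fin_entry_twist (f : {set X} -> {set X} -> nat) S T :
  fin_entry (twist (fin_mx f)) S T = (-1) ^+ (#|S| + #|T|) * (f S T)%:R.
Proof. by rewrite /fin_entry !mxE !enum_rankK. Qed.

(** When [S] differs from [T], toggling a fixed [x] of [S] outside [T] is a sign-reversing
    involution of the interval, so the sum equals its own opposite. *)
Lemma sum_sign_interval S T : T \subset S ->
  \sum_(U : {set X} | (T \subset U) && (U \subset S)) (-1) ^+ #|U|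
    = (S == T)%:R * (-1) ^+ #|T| :> rat.
Proof.
move=> sTS; have [->|neST] := eqVneq S T.
  rewrite (big_pred1 T) ?mul1r // => U /=.
  by rewrite eqEsubset andbC.
have /subsetPn[x xS xT] : ~~ (S \subset T).
  by apply: contra neST => sST; rewrite eqEsubset sST.
pose flip U := if x \in U then U :\ x else x |: U.
have flipK : involutive flip.
  move=> U; rewrite /flip; have [xU|xU] := boolP (x \in U).
    by rewrite !inE eqxx /= setD1K.
  by rewrite setU11 setU1K.
have card_flip U : (-1) ^+ #|flip U| = - (-1) ^+ #|U| :> rat.
  rewrite /flip; have [xU|xU] := boolP (x \in U).
    by rewrite [in RHS](cardsD1 x) xU exprS mulN1r opprK.
  by rewrite cardsU1 xU exprS mulN1r.
set s := \sum_(U | _) _; rewrite mul0r.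
suff /eqP : s = - s.
  by rewrite -addr_eq0 -mulr2n -mulr_natr mulf_eq0 pnatr_eq0 orbF => /eqP.
rewrite {1}/s (reindex_inj (inv_inj flipK)) /= -sumrN.
apply: eq_big => [U|U _]; last exact: card_flip.
rewrite /flip; have [xU|xU] := boolP (x \in U).
  by rewrite subsetD1 xT andbT subDset (setUidPr _) // sub1set.
have TD : T :\ x = T by apply/setDidPl; rewrite disjoint_sym disjoints1.
by rewrite subUset sub1set xS -subDset TD.
Qed.

(** In each entry of the product the factor [e U] of the middle index cancels, leaving [e S / e T]
    times a signed sum over the interval from [T] to [S]. It is applied with [e S] the order of
    [young S]. *)
Lemma ratio_twist_inverse (f : {set X} -> {set X} -> nat) (e : {set X} -> nat) :
  (forall S, 0 < e S)%N ->
  (forall S T, T \subset S -> f S T * e T = e S)%N ->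
  (forall S T, ~~ (T \subset S) -> f S T = 0%N) ->
  fin_mx f *m twist (fin_mx f) = 1%:M.
Proof.
move=> e_gt0 fe f0.
have fE S T : (f S T)%:R = (T \subset S)%:R * ((e S)%:R / (e T)%:R) :> rat.
  case: (boolP (T \subset S)) => [sTS|/f0->]; last by rewrite mul0r.
  by rewrite -(fe S T) // natrM mulfK ?mul1r // pnatr_eq0 -lt0n.
apply/matrixP => i j; rewrite !mxE.
under eq_bigr do rewrite !mxE.
rewrite -(reindex (@enum_val _ {set X}) (P := predT)
  (F := fun U => (f (enum_val i) U)%:R * ((-1) ^+ (#|U| + #|enum_val j|)
     * (f U (enum_val j))%:R))) /=; last by apply: onW_bij; apply: enum_val_bij.
rewrite -(inj_eq enum_val_inj); set S := enum_val i; set T := enum_val j.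
have -> : \sum_U (f S U)%:R * ((-1) ^+ (#|U| + #|T|) * (f U T)%:R) =
   (-1) ^+ #|T| * ((e S)%:R / (e T)%:R) *
   \sum_(U : {set X} | (T \subset U) && (U \subset S)) (-1) ^+ #|U| :> rat.
  rewrite mulr_sumr [RHS]big_mkcond /=; apply: eq_bigr => U _; rewrite !fE.
  case: (T \subset U); last by rewrite mul0r !mulr0.
  case: (U \subset S); last by rewrite !mul0r.
  have eU0 : (e U)%:R != 0 :> rat by rewrite pnatr_eq0 -lt0n.
  by rewrite !mul1r exprD mulrCA (mulrA (_ / _)) divfK // [RHS]mulrC -!mulrA.
case: (boolP (T \subset S)) => sTS.
  rewrite sum_sign_interval //; have [->|_] := eqVneq S T; last by rewrite mul0r mulr0.
  rewrite divff ?mulr1 ?mul1r -?expr2 ?sqrr_sign //.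
  by rewrite pnatr_eq0 -lt0n.
rewrite big_pred0 => [|U]; last first.
  by apply: contraNF sTS => /andP[]; apply: subset_trans.
by rewrite mulr0; case: eqP sTS => // ->; rewrite subxx.
Qed.

(* Moebius inversion on the Boolean lattice, as the case [e = 1]. *)
Lemma sub_twist_inverse :
  fin_mx (fun S T => (T \subset S : nat)) *m
    twist (fin_mx (fun S T => (T \subset S : nat))) = 1%:M.
Proof.
apply: (@ratio_twist_inverse _ (fun=> 1%N)) => // S T; last by move/negPf->.
by move->.
Qed.

Section TwistFactors.
Variables A B C G Z : 'M[rat]_#|{set X}|.
Hypotheses (ZZ : Z *m twist Z = 1%:M) (AA : A *m twist A = 1%:M).
Hypotheses (ABZ : A = B *m Z) (AZC : A = Z *m C) (BZG : B = Z *m G).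

Let ZZ' : twist Z *m Z = 1%:M. Proof. exact: mulmx1C. Qed.
Let BE : B = A *m twist Z. Proof. by rewrite ABZ -mulmxA ZZ mulmx1. Qed.

(** Here [B = A *m twist Z] and [twist C = Z *m twist A], so the inner factors cancel. *)
Lemma twist_factor_middle : B *m twist C = 1%:M.
Proof.
have CE : C = twist Z *m A by rewrite AZC mulmxA ZZ' mul1mx.
rewrite CE BE twistM twistK -mulmxA (mulmxA (twist Z)) ZZ' mul1mx.
exact: AA.
Qed.

(** Cancelling the inner [Z] leaves [twist Z *m (A *m twist A) *m Z]. *)
Lemma twist_factor_inner : G *m twist G = 1%:M.
Proof.
have GE : G = twist Z *m A *m twist Z by rewrite -mulmxA -BE BZG mulmxA ZZ' mul1mx.
rewrite GE !twistM twistK -mulmxA !(mulmxA (twist Z)) ZZ' mul1mx.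
by rewrite -!mulmxA (mulmxA A) AA mul1mx ZZ'.
Qed.

End TwistFactors.

End SubsetMatrices.

(** * Factorisations through the zeta matrix, and the inverses *)

Lemma sum_card_fibre (W Y : finType) (g : W -> Y) (P : pred W) (Q : pred Y) :
  (\sum_y #|[set w | P w && (g w == y)]| * Q y = #|[set w | P w && Q (g w)]|)%N.
Proof.
rewrite -[RHS]sum1dep_card (partition_big g predT) //=; apply: eq_bigr => y _.
rewrite -sum1dep_card big_distrl /= [LHS]big_mkcond [RHS]big_mkcond /=.
apply: eq_bigr => w _; case: eqP => [->|_]; last by rewrite !andbF.
by rewrite !andbT; case: (P w); case: (Q y).
Qed.

Theorem theorem1p4 (n : nat) (n_ge1 : (1 <= n)%N) :
  let A := fin_mx (@num_A n) in
  let B := fin_mx (@num_B n) in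
  let Gamma := fin_mx (@num_Gamma n) in
  [/\ A \in unitmx, B \in unitmx & Gamma \in unitmx] /\
  (forall S T : {set 'I_n.-1},
    [/\ fin_entry (invmx A) S T = (-1) ^+ (#|S| + #|T|) * (num_A S T)%:R,
        fin_entry (invmx B) S T = (-1) ^+ (#|S| + #|T|) * (num_Binv S T)%:R
      & fin_entry (invmx Gamma) S T
          = (-1) ^+ (#|S| + #|T|) * (num_Gamma S T)%:R]).
Proof.
case: n n_ge1 => [//|n] _ A B Gamma.
pose C := fin_mx (@num_Binv n.+1).
pose Z := fin_mx (fun S T : {set 'I_n} => (T \subset S : nat)).
have ZZ : Z *m twist Z = 1%:M := sub_twist_inverse _.
have AA : A *m twist A = 1%:M.
  apply: (ratio_twist_inverse (e := fun S => #|young S|)).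
  - by move=> S; apply: cardG_gt0.
  - exact: card_young_descent.
  - exact: num_A_eq0.
(* Sort the permutations by their exact descent set [U]. *)
have ABZ : A = B *m Z.
  rewrite fin_mx_mul; apply: eq_fin_mx => S T.
  rewrite /num_A -(sum_card_fibre (@descent_set n.+1)
    (fun w => ~: S \subset connectivity_set w) (fun U => T \subset U)).
  by apply: eq_bigr => U _; congr (_ * _)%N; apply: eq_card => w; rewrite !inE eq_sym.
(* Sort by the complement [U] of the connectivity set; the condition on [S] becomes
   [U \subset S]. *)
have AZC : A = Z *m C.
  rewrite fin_mx_mul; apply: eq_fin_mx => S T; under eq_bigr do rewrite mulnC.
  transitivity #|[set w | (T \subset @descent_set n.+1 w)
                  && (~: @connectivity_set n.+1 w \subset S)]|.
    by apply: eq_card => w; rewrite !inE andbC subCset.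
  rewrite -(sum_card_fibre (fun w => ~: @connectivity_set n.+1 w)
    (fun w => T \subset @descent_set n.+1 w) (fun U => U \subset S)).
  apply: eq_bigr => U _; congr (_ * _)%N; apply: eq_card => w.
  by rewrite !inE andbC (can2_eq (@setCK _) (@setCK _)) eq_sym.
have BZG : B = Z *m Gamma.
  rewrite fin_mx_mul; apply: eq_fin_mx => S T; under eq_bigr do rewrite mulnC.
  transitivity #|[set w | (T == @descent_set n.+1 w)
                  && (~: @connectivity_set n.+1 w \subset S)]|.
    by apply: eq_card => w; rewrite !inE andbC subCset.
  rewrite -(sum_card_fibre (fun w => ~: @connectivity_set n.+1 w)
    (fun w => T == @descent_set n.+1 w) (fun U => U \subset S)).
  apply: eq_bigr => U _; congr (_ * _)%N; apply: eq_card => w.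
  by rewrite !inE andbC (can2_eq (@setCK _) (@setCK _)) [T == _]eq_sym.
have [uA iA] := mulmx1_invmx AA.
have [uB iB] := mulmx1_invmx (twist_factor_middle ZZ AA ABZ AZC).
have [uG iG] := mulmx1_invmx (twist_factor_inner ZZ AA ABZ BZG).
by split=> [//|S T]; rewrite iA iB iG; split; apply: fin_entry_twist.
Qed.
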